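(* Let $p=\infty$ and $q\in[1,\infty]$. There exist infinite families of both branching geodesics and deviant geodesics in $(\mathcal{D}_p[l^q], d_p[l^q])$.
   Context: Let $\Delta=\{(x,x):x\in\mathbb{R}\}\subset\mathbb{R}^2$ and $\mathbb{R}^2_>=\{(a,b)\in\mathbb{R}^2: b>a\}$. A persistence diagram is a countable subset of $\mathbb{R}^2_>\times\mathbb{N}$ together with countably infinitely many copies of $\Delta$ (i.e. every point of $\Delta$ is counted with countably infinite multiplicity). The $\mathbb{R}^2$-component of a point is its geometric component; the $\mathbb{N}$-component is an index that only serves to distinguish different copies of the same geometric point, so that a diagram encodes a multiset in $\mathbb{R}^2$. The set of all persistence diagrams is $\mathcal{D}$. The empty diagram $\varnothing$ consists only of the diagonal with countably infinite multiplicity. For points $x,y$ of diagrams, $\|x-y\|_q$ denotes the $q$-norm in $\mathbb{R}^2$ of the difference of their geometric components (the index is ignored). For $X,Y\in\mathcal{D}$ and a bijection $\varphi:X\to Y$ (all diagonal copies included), put $C_p[l^q](\varphi)=\left(\sum_{x\in X}\|x-\varphi(x)\|_q^p\right)^{1/p}$ if $p<\infty$ and $C_\infty[l^q](\varphi)=\sup_{x\in X}\|x-\varphi(x)\|_q$. Define $d_p[l^q](X,Y)=\inf\{C_p[l^q](\varphi): \varphi:X\to Y \text{ a bijection}\}\in[0,\infty]$; a bijection attaining the infimum is called optimal. Let $\mathcal{D}_p[l^q]=\{X\in\mathcal{D}: d_p[l^q](X,\varnothing)<\infty\}$. A geodesic in $\mathcal{D}_p[l^q]$ is a continuous map $\gamma:[0,1]\to\mathcal{D}_p[l^q]$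 with $d_p[l^q](\gamma(s),\gamma(t))=|t-s|\,d_p[l^q](\gamma(0),\gamma(1))$ for all $s,t\in[0,1]$; it is a geodesic from $\gamma(0)$ to $\gamma(1)$. A convex-combination geodesic from $X$ to $Y$ is a geodesic of the form $\gamma(0)=X$, $\gamma(1)=Y$, $\gamma(t)=\{(1-t)x+t\varphi(x):x\in X\}$ for $t\in(0,1)$, where $\varphi:X\to Y$ is an optimal bijection; here $\gamma(t)$ is understood as a multiset of geometric points (diagonal with countably infinite multiplicity), the indexing coordinates being ignored. A geodesic not of this form (indexing coordinates again being ignored) is called deviant. A geodesic $\gamma:[0,1]\to\mathcal{D}_p[l^q]$ branches at $t_0\in(0,1)$ (and is called a branching geodesic) if there exists a geodesic $\widetilde\gamma:[0,1]\to\mathcal{D}_p[l^q]$ that agrees with $\gamma$ on $[0,t_0]$ and is distinct from $\gamma$ on $(t_0,t_0+\varepsilon]$ for some $\varepsilon>0$. *)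

(* Defs.v *)
From mathcomp Require Import all_boot all_order all_algebra.
From mathcomp Require Import all_classical all_reals all_analysis.
Set Implicit Arguments.
Unset Strict Implicit.
Unset Printing Implicit Defensive.
Import Order.TTheory GRing.Theory Num.Theory.
Local Open Scope card_scope.
Local Open Scope classical_set_scope.
Local Open Scope ring_scope.

(* A point of the plane together with an index telling apart the copies of
   the same geometric point. *)
Definition dgm_point (R : realType) : Type := ((R * R) * nat)%type.

(* Only the off-diagonal part is stored; the copies of the diagonal are added
   by [points]. *)
Record diagram (R : realType) := Diagram {
  offdiag : set (dgm_point R);
  offdiag_countable : countable offdiag;
  offdiag_above : offdiag `<=` [set x | x.1.1 < x.1.2] }.

Definition points (R : realType) (X : diagram R) : set (dgm_point R) :=
  offdiag X `|` [set x | x.1.1 = x.1.2].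

Definition empty_diagram (R : realType) : diagram R :=
  @Diagram R set0 (countable0 _) (@sub0set _ _).

(* Equality of the underlying multisets of geometric points. *)
Definition same_diagram (R : realType) (X Y : diagram R) : Prop :=
  forall z : R * R,
    [set x | offdiag X x /\ x.1 = z] #= [set y | offdiag Y y /\ y.1 = z].

(* The q-norm of R^2; only 1 <= q <= +oo is meaningful. *)
Definition qnorm (R : realType) (q : \bar R) (v : R * R) : R :=
  match q with
  | EFin r => (`|v.1| `^ r + `|v.2| `^ r) `^ r^-1
  | _ => Num.max `|v.1| `|v.2|
  end.

Definition qdist (R : realType) (q : \bar R) (x y : dgm_point R) : R :=
  qnorm q (x.1.1 - y.1.1, x.1.2 - y.1.2).

Definition cost (R : realType) (p q : \bar R) (X : diagram R)
    (phi : dgm_point R -> dgm_point R) : \bar R :=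
  match p with
  | EFin r =>
      ((\esum_(x in points X) ((qdist q x (phi x)) `^ r)%R%:E) `^ r^-1)%E
  | _ => ereal_sup [set (qdist q x (phi x))%:E | x in points X]
  end.

(* A bijection X -> Y is the restriction to [points X] of a total map. *)
Definition dgm_bij (R : realType) (X Y : diagram R)
    (phi : dgm_point R -> dgm_point R) : Prop :=
  set_bij (points X) (points Y) phi.

Definition dgm_dist (R : realType) (p q : \bar R) (X Y : diagram R) : \bar R :=
  ereal_inf [set cost p q X phi | phi in [set phi | dgm_bij X Y phi]].

Definition optimal (R : realType) (p q : \bar R) (X Y : diagram R)
    (phi : dgm_point R -> dgm_point R) : Prop :=
  dgm_bij X Y phi /\ cost p q X phi = dgm_dist p q X Y.

Definition dgm_space (R : realType) (p q : \bar R) : set (diagram R) :=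
  [set X | (dgm_dist p q X (empty_diagram R) < +oo)%E].

(* Paths are total maps on R of which only the values on [0, 1] matter. *)
Definition same_path (R : realType) (g h : R -> diagram R) : Prop :=
  forall t : R, 0 <= t <= 1 -> same_diagram (g t) (h t).

Definition path_continuous (R : realType) (p q : \bar R)
    (g : R -> diagram R) : Prop :=
  forall t : R, 0 <= t <= 1 -> forall e : R, 0 < e -> exists2 d : R, 0 < d &
    forall s : R, 0 <= s <= 1 -> `|s - t| < d ->
      (dgm_dist p q (g s) (g t) < e%:E)%E.

Definition geodesic (R : realType) (p q : \bar R)
    (g : R -> diagram R) : Prop :=
  [/\ forall t : R, 0 <= t <= 1 -> dgm_space p q (g t),
      path_continuous p q g &
      forall s t : R, 0 <= s <= 1 -> 0 <= t <= 1 ->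
        dgm_dist p q (g s) (g t) =
          (`|(t - s)%R|%:E * dgm_dist p q (g 0%R) (g 1%R))%E].

Definition convex_comb (R : realType) (t : R) (x y : dgm_point R) : R * R :=
  ((1 - t) * x.1.1 + t * y.1.1, (1 - t) * x.1.2 + t * y.1.2).

(* [g t] and {(1 - t) x + t phi(x) : x} are compared as multisets off the
   diagonal only: the diagonal has countably infinite multiplicity in both by
   convention. *)
Definition convex_comb_geodesic (R : realType) (p q : \bar R)
    (g : R -> diagram R) : Prop :=
  geodesic p q g /\
  exists2 phi, optimal p q (g 0) (g 1) phi &
    forall t : R, 0 < t < 1 -> forall z : R * R, z.1 < z.2 ->
      [set x | points (g 0) x /\ convex_comb t x (phi x) = z] #=
      [set y | offdiag (g t) y /\ y.1 = z].

Definition deviant (R : realType) (p q : \bar R)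
    (g : R -> diagram R) : Prop :=
  geodesic p q g /\ ~ convex_comb_geodesic p q g.

Definition branches_at (R : realType) (p q : \bar R)
    (g : R -> diagram R) (t0 : R) : Prop :=
  exists2 h : R -> diagram R, geodesic p q h &
    (forall t : R, 0 <= t <= t0 -> same_diagram (h t) (g t)) /\
    (exists e : R, [/\ 0 < e, t0 + e <= 1 &
      forall t : R, t0 < t <= t0 + e -> ~ same_diagram (h t) (g t)]).

Definition branching (R : realType) (p q : \bar R)
    (g : R -> diagram R) : Prop :=
  geodesic p q g /\ exists2 t0 : R, 0 < t0 < 1 & branches_at p q g t0.

(* Infinitely many paths satisfy P, paths being identified when they coincide
   as maps from [0, 1] to multisets. *)
Definition infinite_family (R : realType)
    (P : (R -> diagram R) -> Prop) : Prop :=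
  exists F : nat -> R -> diagram R,
    (forall n, P (F n)) /\ (forall m n, m <> n -> ~ same_path (F m) (F n)).

(* Main.v *)
Require Import Defs.
From mathcomp Require Import all_boot all_order all_algebra.
From mathcomp Require Import all_classical all_reals all_analysis.
From mathcomp Require Import lra.
Import Order.TTheory GRing.Theory Num.Theory.
Local Open Scope classical_set_scope.
Local Open Scope ring_scope.

(* For p = oo the distance only sees the fastest point.  Consider diagrams with
   two far apart off-diagonal points.  As long as the left one moves vertically
   at unit speed, the right one may move along any 1-Lipschitz path without
   affecting the distances, which gives branching at will.  If the right point
   leaves its initial position and comes back to it, then an optimal bijection
   between the end diagrams has to fix it, so that the geodesic is deviant. *)

(** * Coordinate bounds for the q-norm, bounds for the sup cost *)

Lemma qnorm_ge_abs1 {R : realType} {q : \bar R} (a b : R) :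
  (1 <= q)%E -> `|a| <= qnorm q (a, b).
Proof.
case: q => [r| |//] /=; last by rewrite le_max lexx.
rewrite lee_fin => r1.
have r0 : r != 0 by lra.
have {1}-> : `|a| = (`|a| `^ r) `^ r^-1 by rewrite -powRrM mulfV// powRr1.
apply: ge0_ler_powR; rewrite ?nnegrE ?addr_ge0 ?powR_ge0 ?lerDl ?powR_ge0//.
by rewrite invr_ge0; lra.
Qed.

Lemma qnormC {R : realType} (q : \bar R) (a b : R) :
  qnorm q (a, b) = qnorm q (b, a).
Proof. by case: q => [r| |] /=; [rewrite addrC|rewrite maxC|rewrite maxC]. Qed.

Lemma qnorm_ge_abs2 {R : realType} {q : \bar R} (a b : R) :
  (1 <= q)%E -> `|b| <= qnorm q (a, b).
Proof. by rewrite qnormC; exact: qnorm_ge_abs1. Qed.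

Lemma qnorm0l {R : realType} {q : \bar R} (b : R) :
  (1 <= q)%E -> qnorm q (0, b) = `|b|.
Proof.
case: q => [r| |//] /=; last by rewrite normr0 => _; apply/max_idPr.
rewrite lee_fin => r1; have r0 : r != 0 by lra.
by rewrite normr0 powR0// add0r -powRrM mulfV// powRr1.
Qed.

Lemma cost_oo_le {R : realType} (q : \bar R) (X : diagram R)
    (phi : dgm_point R -> dgm_point R) (c : R) :
  (forall x, points X x -> qdist q x (phi x) <= c) ->
  (cost +oo%E q X phi <= c%:E)%E.
Proof.
move=> phic; apply: ge_ereal_sup => _ [x Xx <-].
by rewrite lee_fin phic.
Qed.

Lemma qdist_le_cost {R : realType} (q : \bar R) (X : diagram R)
    (phi : dgm_point R -> dgm_point R) (x : dgm_point R) :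
  points X x -> ((qdist q x (phi x))%:E <= cost +oo%E q X phi)%E.
Proof. by move=> Xx; apply: ereal_sup_ubound; exists x. Qed.

(** An equality of multisets, once given, is exploited only in this weak form: a point on one side
    has a partner on the other. *)
Lemma card_eq_witness {T U : Type} {A : set T} {B : set U} {x : T} :
  (A #= B)%card -> A x -> exists y, B y.
Proof.
have [//|/nonemptyPn ->] := pselect (B !=set0).
by rewrite card_eq0 => /eqP ->.
Qed.

Lemma same_diagram_offdiag {R : realType} {X Y : diagram R} {x : dgm_point R} :
  same_diagram X Y -> offdiag X x -> exists2 y, offdiag Y y & y.1 = x.1.
Proof.
by move=> /(_ x.1)/card_eq_witness XY Xx; have [//|y []] := XY x; exists y.
Qed.

(** * Diagrams with two points and the matchings between them *)

(** The absolute value keeps the point above the diagonal for every real parameter, as paths are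
    total maps on [R]. Both points lie at height at least 3 above the diagonal and their abscissas
    differ by 3, too far for a move of length 1. *)
Definition left_point {R : realType} (u : R) : dgm_point R :=
  ((0, 3 + `|u|), 0%N).

Definition right_point {R : realType} (v : R) : dgm_point R :=
  ((3, 6 + `|v|), 0%N).

Lemma two_points_above {R : realType} (u v : R) :
  [set left_point u; right_point v] `<=` [set x | x.1.1 < x.1.2].
Proof.
have u0 := normr_ge0 u; have v0 := normr_ge0 v.
by move=> _ [|] -> /=; lra.
Qed.

Definition two_points {R : realType} (u v : R) : diagram R :=
  Diagram (finite_set_countable (finite_set2 (left_point u) (right_point v)))
    (two_points_above u v).

Lemma left_in {R : realType} (u v : R) :
  points (two_points u v) (left_point u).
Proof. by left; left. Qed.

Lemma right_in {R : realType} (u v : R) :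
  points (two_points u v) (right_point v).
Proof. by left; right. Qed.

(** The abscissa 3 singles out the right point, whose ordinate determines its nonnegative
    parameter. *)
Lemma same_two_points {R : realType} {u v u' v' : R} :
  0 <= v -> 0 <= v' ->
  same_diagram (two_points u v) (two_points u' v') -> v = v'.
Proof.
move=> v0 v'0 /same_diagram_offdiag /(_ (or_intror erefl)).
by move=> -[_ [|] -> /= []]; rewrite ?(ger0_norm v0) ?(ger0_norm v'0); lra.
Qed.

Definition move_two {R : realType} (u v u' v' : R) (x : dgm_point R) :
    dgm_point R :=
  if x == left_point u then left_point u'
  else if x == right_point v then right_point v' else x.

Lemma right_neq_left {R : realType} (u v : R) :
  (right_point v == left_point u) = false.
Proof. by apply/negbTE/negP => /eqP[]; lra. Qed.

Lemma left_offdiag {R : realType} (u : R) :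
  (left_point u).1.1 <> (left_point u).1.2.
Proof. by have u0 := normr_ge0 u; move=> /=; lra. Qed.

Lemma right_offdiag {R : realType} (v : R) :
  (right_point v).1.1 <> (right_point v).1.2.
Proof. by have v0 := normr_ge0 v; move=> /=; lra. Qed.

Lemma move_two_left {R : realType} (u v u' v' : R) :
  move_two u v u' v' (left_point u) = left_point u'.
Proof. by rewrite /move_two eqxx. Qed.

Lemma move_two_right {R : realType} (u v u' v' : R) :
  move_two u v u' v' (right_point v) = right_point v'.
Proof. by rewrite /move_two right_neq_left eqxx. Qed.

Lemma move_two_diag {R : realType} (u v u' v' : R) (x : dgm_point R) :
  x.1.1 = x.1.2 -> move_two u v u' v' x = x.
Proof.
rewrite /move_two; case: eqP => [->/left_offdiag//|_].
by case: eqP => [->/right_offdiag|].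
Qed.

Lemma move_two_fun {R : realType} (u v u' v' : R) (x : dgm_point R) :
  points (two_points u v) x ->
  points (two_points u' v') (move_two u v u' v' x).
Proof.
move=> [[|] ->|x12].
- by rewrite move_two_left; exact: left_in.
- by rewrite move_two_right; exact: right_in.
- by rewrite move_two_diag//; right.
Qed.

Lemma move_twoK {R : realType} (u v u' v' : R) (x : dgm_point R) :
  points (two_points u v) x ->
  move_two u' v' u v (move_two u v u' v' x) = x.
Proof.
move=> [[|] ->|x12]; first by rewrite !move_two_left.
  by rewrite !move_two_right.
by rewrite !move_two_diag.
Qed.

Lemma move_two_bij {R : realType} (u v u' v' : R) :
  dgm_bij (two_points u v) (two_points u' v') (move_two u v u' v').
Proof.
split.
- exact: move_two_fun.
- move=> x y; rewrite !inE => Xx Xy /(congr1 (move_two u' v' u v)).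
  by rewrite !move_twoK.
- move=> y Yy; exists (move_two u' v' u v y); first exact: move_two_fun.
  exact: move_twoK.
Qed.

(** * Distances between diagrams with two points *)

Lemma qdist_same_column {R : realType} {q : \bar R} (a b c : R) (m n : nat) :
  (1 <= q)%E -> qdist q (a, b, m) (a, c, n) = `|b - c|.
Proof. by move=> q1; rewrite /qdist /= subrr qnorm0l. Qed.

Lemma dist_two_points_le {R : realType} {q : \bar R} (u v u' v' c : R) :
  (1 <= q)%E -> `|u - u'| <= c -> `|v - v'| <= c ->
  (dgm_dist +oo%E q (two_points u v) (two_points u' v') <= c%:E)%E.
Proof.
move=> q1 uc vc; apply: ge_ereal_inf.
exists (cost +oo%E q (two_points u v) (move_two u v u' v')).
  by exists (move_two u v u' v') => //; exact: move_two_bij.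
have shift (h a b : R) : h + `|a| - (h + `|b|) = `|a| - `|b| by lra.
apply: cost_oo_le => x [[|] ->|x12].
- by rewrite move_two_left qdist_same_column// shift (le_trans (ler_dist_dist _ _)).
- by rewrite move_two_right qdist_same_column// shift (le_trans (ler_dist_dist _ _)).
- rewrite move_two_diag// /qdist !subrr qnorm0l// normr0.
  exact: le_trans uc.
Qed.

(** Each coordinate changes by at most 1, which reaches neither the abscissa 3 nor the diagonal. *)
Lemma near_left_point {R : realType} {q : \bar R} (u u' v' : R)
    (y : dgm_point R) : (1 <= q)%E -> points (two_points u' v') y ->
  qdist q (left_point u) y <= 1 -> y = left_point u'.
Proof.
have u0 := normr_ge0 u => q1 Yy d1.
have := le_trans (qnorm_ge_abs1 _ _ q1) d1.
have := le_trans (qnorm_ge_abs2 _ _ q1) d1.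
rewrite !ler_norml.
by case: Yy => [[|] ->|/= ->] //= /andP[? ?] /andP[? ?]; exfalso; lra.
Qed.

Lemma near_right_point {R : realType} {q : \bar R} (v u' v' : R)
    (y : dgm_point R) : (1 <= q)%E -> points (two_points u' v') y ->
  qdist q (right_point v) y <= 1 -> y = right_point v'.
Proof.
have v0 := normr_ge0 v => q1 Yy d1.
have := le_trans (qnorm_ge_abs1 _ _ q1) d1.
have := le_trans (qnorm_ge_abs2 _ _ q1) d1.
rewrite !ler_norml.
by case: Yy => [[|] ->|/= ->] //= /andP[? ?] /andP[? ?]; exfalso; lra.
Qed.

(** A bijection either matches the left points, at cost at least [|u - u'|], or moves the left point
    by at least 1, which is no cheaper for parameters in [0, 1]. *)
Lemma dist_two_points_ge {R : realType} {q : \bar R} (u v u' v' : R) :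
  (1 <= q)%E -> 0 <= u <= 1 -> 0 <= u' <= 1 ->
  (`|u - u'|%:E <= dgm_dist +oo%E q (two_points u v) (two_points u' v'))%E.
Proof.
move=> q1 /andP[u0 u1] /andP[u'0 u'1].
apply: le_ereal_inf_tmp => _ [phi [phifun _ _] <-].
apply: le_trans (qdist_le_cost _ _ _ _ (left_in u v)); rewrite lee_fin.
have [d1|/ltW d1] := leP (qdist q (left_point u) (phi (left_point u))) 1.
  rewrite (near_left_point _ _ _ _ q1 (phifun _ (left_in u v)) d1).
  rewrite qdist_same_column// (ger0_norm u0) (ger0_norm u'0).
  by rewrite opprD addrACA subrr add0r.
by apply: le_trans d1; rewrite ler_norml; lra.
Qed.

Lemma dist_two_points {R : realType} {q : \bar R} (u v u' v' : R) :
  (1 <= q)%E -> 0 <= u <= 1 -> 0 <= u' <= 1 -> `|v - v'| <= `|u - u'| ->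
  dgm_dist +oo%E q (two_points u v) (two_points u' v') = `|u - u'|%:E.
Proof.
move=> q1 u01 u'01 vu; apply/eqP; rewrite eq_le.
by rewrite dist_two_points_le// dist_two_points_ge.
Qed.

(** * Finite distance to the empty diagram *)

(* The diagonal copies with the abscissa of one of the two points are shifted
   by one, so as to make room for its projection. *)
Definition collapse {R : realType} (x : dgm_point R) : dgm_point R :=
  ((x.1.1, x.1.1),
   if (x.1.1 == 0) || (x.1.1 == 3) then
     if x.1.1 == x.1.2 then x.2.+1 else 0%N
   else x.2).

Lemma collapse_bij {R : realType} (u v : R) :
  dgm_bij (two_points u v) (empty_diagram R) collapse.
Proof.
have u0 := normr_ge0 u; have v0 := normr_ge0 v.
have n30 : ((3 : R) == 0) = false by apply/negbTE; lra.
have lne : (0 == 3 + `|u|) = false by apply/negbTE; lra.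
have rne : (3 == 6 + `|v|) = false by apply/negbTE; lra.
split.
- by move=> x _; right.
- move=> [[a b] n] [[a' b'] n']; rewrite !inE /collapse.
  move=> [[|] [-> -> ->]|/= <-] [[|] [-> -> ->]|/= <-] //= [];
    rewrite ?eqxx ?n30 ?lne ?rne ?orbT //=; try by move=> *; exfalso; lra.
  + by move=> <- _; rewrite eqxx.
  + by move=> <- _; rewrite eqxx orbT.
  + by move=> -> _; rewrite eqxx.
  + by move=> -> _; rewrite eqxx orbT.
  + by move=> <- _; case: ifP => _ => [[->]|->].
- move=> [[a b] n] [//|/= <-].
  have [a03|a03] := boolP ((a == 0) || (a == 3)); last first.
    by exists ((a, a), n); [right|rewrite /collapse /= (negbTE a03)].
  case: n => [|n]; last first.
    by exists ((a, a), n); [right|rewrite /collapse /= a03 eqxx].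
  case/orP: a03 => /eqP ->.
    by exists (left_point u); [exact: left_in|rewrite /collapse /= eqxx lne].
  exists (right_point v); first exact: right_in.
  by rewrite /collapse /= eqxx rne orbT.
Qed.

Lemma two_points_space {R : realType} {q : \bar R} (u v : R) :
  (1 <= q)%E -> dgm_space +oo%E q (two_points u v).
Proof.
move=> q1; have u0 := normr_ge0 u; have v0 := normr_ge0 v.
(* The vertical projection moves the left point by [3 + |u|] and the right one by [3 + |v|]; the sum
   bounds both. *)
apply: (@le_lt_trans _ _ (3 + `|u| + `|v|)%:E); last exact: ltry.
apply: ge_ereal_inf.
exists (cost +oo%E q (two_points u v) collapse).
  by exists collapse => //; exact: collapse_bij.
apply: cost_oo_le => -[[a b] n] Xx.
rewrite qdist_same_column// ler_norml.
by case: Xx => [[|] [-> -> _]|/= ->] /=; lra.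
Qed.

(** * Geodesics with a freely moving right point *)

Definition two_points_path {R : realType} (f : R -> R) (t : R) : diagram R :=
  two_points t (f t).

(** The left point moves by exactly [|s - t|] and the right one by no more, so the distance is
    [|s - t|], and 1 between the ends. *)
Lemma two_points_geodesic {R : realType} {q : \bar R} (f : R -> R) :
  (1 <= q)%E -> (forall s t, `|f s - f t| <= `|s - t|) ->
  geodesic +oo%E q (two_points_path f).
Proof.
move=> q1 lipf; split.
- by move=> t _; exact: two_points_space.
- move=> t t01 e e0; exists e => // s s01 se.
  by rewrite dist_two_points// lte_fin.
- move=> s t s01 t01; rewrite !dist_two_points ?lexx ?ler01//.
  by rewrite distrC sub0r normrN normr1 mule1.
Qed.

Theorem theorem7 (R : realType) (p q : \bar R)
  (hp : p = +oo%E) (hq : (1 <= q)%E) :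
  infinite_family (@branching R p q) /\ infinite_family (@deviant R p q).
Proof.
subst p; have half : 0 < (2^-1 : R) < 1 by lra.
split.
(* The right point rests at height [6 + n], which tells the members of the family apart. *)
- exists (fun n => two_points_path (fun=> n%:R)); split=> [n|m n mn mnE].
  + split; first by apply: two_points_geodesic => // s t; rewrite subrr normr0.
    exists 2^-1 => //.
    (* The competitor lets the right point rest until time 1/2, then rise at unit speed. *)
    exists (two_points_path (fun t => n%:R + Num.max 0 (t - 2^-1))).
      apply: two_points_geodesic => // s t.
      rewrite opprD addrACA subrr add0r.
      by rewrite /Num.max; do 2!case: ifPn => ?; do 2!case: ger0P => ?; lra.
    split.
      move=> t /andP[_ t2]; rewrite /two_points_path.
      rewrite (max_idPl _) ?addr0; last by lra.
      by move=> z; exact: card_eqxx.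
    exists 2^-1; split=> [||t /andP[t2 _]]; [lra|lra|].
    have n0 : (0 : R) <= n%:R by exact: ler0n.
    rewrite /two_points_path (max_idPr _); last by lra.
    move=> same; suff : n%:R + (t - 2^-1) = n%:R by lra.
    by apply: same_two_points same; lra.
  + apply: mn; apply/eqP; rewrite -(@eqr_nat R); apply/eqP.
    apply: same_two_points (mnE 0 _); rewrite ?ler0n//; lra.
(* The right point descends by 1/2 until time 1/2, then climbs back to its initial position. *)
- exists (fun n => two_points_path (fun t => n%:R + `|t - 2^-1|)).
  split=> [n|m n mn mnE].
  + split.
      apply: two_points_geodesic => // s t.
      rewrite opprD addrACA subrr add0r.
      by apply: le_trans (ler_dist_dist _ _) _; rewrite opprB addrA subrK.
    move=> [_ [phi [[phifun _ _] phiopt]] /(_ 2^-1 half)].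
    have n0 : (0 : R) <= n%:R by exact: ler0n.
    have ends : `|(1 - 2^-1 : R)| = `|0 - 2^-1 : R|.
      by rewrite sub0r normrN; congr (`|_|); lra.
    move: phifun phiopt; rewrite /two_points_path ends subrr normr0 addr0.
    set v := n%:R + _ => phifun phiopt.
    have vn : n%:R + 2^-1 = v.
      by rewrite /v sub0r normrN ger0_norm//; lra.
    (* An optimal bijection has cost 1, so it cannot send the right point anywhere but to the right
       point of the final diagram, which is the same point. *)
    have phir : phi (right_point v) = right_point v.
      apply: (near_right_point v 1 v _ hq); first exact/phifun/right_in.
      rewrite -lee_fin.
      apply: le_trans (qdist_le_cost _ _ _ _ (right_in 0 v)) _.
      rewrite phiopt dist_two_points ?lexx ?ler01//.
        by rewrite sub0r normrN normr1.
      by rewrite subrr normr0.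
    have rabove := two_points_above 0 v _ (or_intror erefl).
    (* The convex combination at time 1/2 still contains this fixed point, whereas the right point
       of the path has then sunk to height [6 + n]. *)
    move=> /(_ (right_point v).1 rabove)/card_eq_witness mid.
    have [|y [yg yr]] := mid (right_point v).
      split; first exact: right_in.
      by rewrite phir /convex_comb /=; congr (_, _); lra.
    case: yg yr => -> [].
      lra.
    rewrite (ger0_norm n0) (ger0_norm (_ : 0 <= v)); lra.
  + apply: mn; apply/eqP; rewrite -(@eqr_nat R); apply/eqP.
    (* At time 0 all members share the offset 1/2, which cancels. *)
    apply/(@addIr _ `|0 - 2^-1|).
    by apply: same_two_points (mnE 0 _); rewrite ?addr_ge0 ?ler0n//; lra.
Qed.
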